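(* Let $S$ be a set, let $\mathbf{M}$ be an $S$-distributive monoidal domain, and let $\mathbf{A},\mathbf{B}$ be $\mathbf{M}$-categories with object set $S$. If $(\widetilde{R},|\cdots|)$ is a simple twisting system between $\mathbf{B}$ and $\mathbf{A}$, then the data $\mathbf{A}\otimes_R\mathbf{B}$ (hom-objects, compositions ${}_xc_z^y$ and identities $1_x$ as defined in the context) form an $\mathbf{M}$-category, and it factorizes through $\mathbf{A}$ and $\mathbf{B}$ (with respect to the $\mathbf{M}$-functors $\alpha:\mathbf{A}\to\mathbf{A}\otimes_R\mathbf{B}$ and $\beta:\mathbf{B}\to\mathbf{A}\otimes_R\mathbf{B}$ defined in the context).
   Context: $(\mathbf{M},\otimes,\mathbf{1})$ is a monoidal category; associativity and unit constraints are suppressed, and the identity morphism of an object $X$ is also denoted $X$. $\mathbf{M}$ is $S$-distributive if every $S$-indexed family $\{X_i\}_{i\in S}$ of objects has a coproduct $(\bigoplus_{i\in S}X_i,\{\sigma_i\}_{i\in S})$ and, for every object $X$, $(X\otimes\bigoplus_iX_i,\{X\otimes\sigma_i\})$ and $((\bigoplus_iX_i)\otimes X,\{\sigma_i\otimes X\})$ are coproducts of $\{X\otimes X_i\}$ and $\{X_i\otimes X\}$. $\mathbf{M}$ is a domain if the tensor product of two objects is an initial object if and only if at least one of them is an initial object (a monoidal category without initial objects is a domain by convention). An $\mathbf{M}$-category $\mathbf{A}$ with object set $S$ consists of objects ${}_xA_y$ of $\mathbf{M}$ (playing the role of $\mathrm{Hom}(y,x)$), composition morphisms ${}_xa_z^y:{}_xA_y\otimes{}_yA_z\to{}_xA_z$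 and identities $1_x^A:\mathbf{1}\to{}_xA_x$, satisfying the usual associativity and unit axioms; for $\mathbf{B}$ the data are ${}_xB_y,{}_xb_z^y,1_x^B$. An $\mathbf{M}$-functor (identity on objects) $\alpha:\mathbf{A}\to\mathbf{C}$ is a family ${}_x\alpha_y:{}_xA_y\to{}_xC_y$ with ${}_x\alpha_x\circ1_x^A=1_x^C$ and ${}_xc_z^y\circ({}_x\alpha_y\otimes{}_y\alpha_z)={}_x\alpha_z\circ{}_xa_z^y$. Simple twisting system. A pair $(\widetilde{R},|\cdots|)$ consisting of a function $|\cdots|:S^3\to S$ and morphisms ${}_x\widetilde{R}_z^y:{}_xB_y\otimes{}_yA_z\to{}_xA_{|xyz|}\otimes{}_{|xyz|}B_z$ ($x,y,z\in S$) is a simple twisting system between $\mathbf{B}$ and $\mathbf{A}$ if, for all $x,y,z,t\in S$: (i) if ${}_xB_y\otimes{}_yB_z\otimes{}_zA_t$ is not initial, then $|xy|yzt||=|xzt|$ and $({}_xA_{|xzt|}\otimes{}_{|xzt|}b_t^{|yzt|})\circ({}_x\widetilde{R}_{|yzt|}^y\otimes{}_{|yzt|}B_t)\circ({}_xB_y\otimes{}_y\widetilde{R}_t^z)={}_x\widetilde{R}_t^z\circ({}_xb_z^y\otimes{}_zA_t)$; (ii) if ${}_xB_y\otimes{}_yA_z\otimes{}_zA_t$ is not initial, then $||xyz|zt|=|xyt|$ and $({}_xa_{|xyt|}^{|xyz|}\otimes{}_{|xyt|}B_t)\circ({}_xA_{|xyz|}\otimes{}_{|xyz|}\widetilde{R}_t^z)\circ({}_x\widetilde{R}_z^y\otimes{}_zA_t)={}_x\widetilde{R}_t^y\circ({}_xB_y\otimes{}_ya_t^z)$;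 (iii) if ${}_xA_y$ is not initial, then $|xxy|=y$ and ${}_x\widetilde{R}_y^x\circ(1_x^B\otimes{}_xA_y)={}_xA_y\otimes1_y^B$; (iv) if ${}_xB_y$ is not initial, then $|xyy|=x$ and ${}_x\widetilde{R}_y^y\circ({}_xB_y\otimes1_y^A)=1_x^A\otimes{}_xB_y$; (v) if ${}_xB_y\otimes{}_yA_z$ is not initial, then ${}_xA_{|xyz|}\otimes{}_{|xyz|}B_z$ is not initial. The data $\mathbf{A}\otimes_R\mathbf{B}$. The object set is $S$ and ${}_x(\mathbf{A}\otimes_R\mathbf{B})_y:={}_xA_{\overline{u}}B_y:=\bigoplus_{u\in S}{}_xA_u\otimes{}_uB_y$, with canonical inclusions ${}_x\sigma_y^u:{}_xA_u\otimes{}_uB_y\to{}_xA_{\overline{u}}B_y$. The composition ${}_xc_z^y:{}_xA_{\overline{u}}B_y\otimes{}_yA_{\overline{v}}B_z\to{}_xA_{\overline{u}}B_z$ is the unique morphism such that for all $u,v\in S$ $${}_xc_z^y\circ({}_x\sigma_y^u\otimes{}_y\sigma_z^v)={}_x\sigma_z^{|uyv|}\circ({}_xa_{|uyv|}^u\otimes{}_{|uyv|}b_z^v)\circ({}_xA_u\otimes{}_u\widetilde{R}_v^y\otimes{}_vB_z).$$ The identities are $1_x:={}_x\sigma_x^x\circ(1_x^A\otimes1_x^B)$. Moreover ${}_x\alpha_y:={}_x\sigma_y^y\circ({}_xA_y\otimes1_y^B)$ and ${}_x\beta_y:={}_x\sigma_y^x\circ(1_x^A\otimes{}_xB_y)$.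 Factorization. An $\mathbf{M}$-category $\mathbf{C}$ with object set $S$ factorizes through $\mathbf{A}$ and $\mathbf{B}$, with respect to $\mathbf{M}$-functors $\alpha:\mathbf{A}\to\mathbf{C}$, $\beta:\mathbf{B}\to\mathbf{C}$ that are the identity on objects, if for all $x,y\in S$ the unique morphism ${}_x\varphi_y:{}_xA_{\overline{u}}B_y\to{}_xC_y$ with ${}_x\varphi_y\circ{}_x\sigma_y^u={}_xc_y^u\circ({}_x\alpha_u\otimes{}_u\beta_y)$ for all $u\in S$ is an isomorphism. *)

(* Defs.v *)
From mathcomp Require Import ssreflect ssrfun ssrbool.

Set Implicit Arguments.
Unset Strict Implicit.
Unset Printing Implicit Defensive.

Declare Scope moncat_scope.
Delimit Scope moncat_scope with moncat.
Local Open Scope moncat_scope.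

Reserved Notation "X ~> Y" (at level 55, no associativity).
Reserved Notation "g ∘ f" (at level 40, left associativity).
Reserved Notation "X ⊗ Y" (at level 39, left associativity).
Reserved Notation "f ⊗₁ g" (at level 39, left associativity).

(* The monoidal category is not assumed to be strict: the associativity and
   unit constraints appear explicitly here and in all later definitions. *)
Record moncat := MonCat {
  Ob :> Type;
  Hom : Ob -> Ob -> Type where "X ~> Y" := (Hom X Y);
  idm : forall X, X ~> X;
  compm : forall X Y Z, Y ~> Z -> X ~> Y -> X ~> Z
    where "g ∘ f" := (compm g f);
  tensor : Ob -> Ob -> Ob where "X ⊗ Y" := (tensor X Y);
  tensorm : forall X X' Y Y', X ~> X' -> Y ~> Y' -> X ⊗ Y ~> X' ⊗ Y'
    where "f ⊗₁ g" := (tensorm f g);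
  unit_ob : Ob;
  assoc : forall X Y Z, (X ⊗ Y) ⊗ Z ~> X ⊗ (Y ⊗ Z);
  assocV : forall X Y Z, X ⊗ (Y ⊗ Z) ~> (X ⊗ Y) ⊗ Z;
  lunit : forall X, unit_ob ⊗ X ~> X;
  lunitV : forall X, X ~> unit_ob ⊗ X;
  runit : forall X, X ⊗ unit_ob ~> X;
  runitV : forall X, X ~> X ⊗ unit_ob;
  comp_idl : forall X Y (f : X ~> Y), idm Y ∘ f = f;
  comp_idr : forall X Y (f : X ~> Y), f ∘ idm X = f;
  comp_assoc : forall X Y Z T (f : X ~> Y) (g : Y ~> Z) (h : Z ~> T),
    h ∘ (g ∘ f) = (h ∘ g) ∘ f;
  tensor_id : forall X Y, idm X ⊗₁ idm Y = idm (X ⊗ Y);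
  tensor_comp : forall X X' X'' Y Y' Y''
    (f : X ~> X') (f' : X' ~> X'') (g : Y ~> Y') (g' : Y' ~> Y''),
    (f' ∘ f) ⊗₁ (g' ∘ g) = (f' ⊗₁ g') ∘ (f ⊗₁ g);
  assocK : forall X Y Z, assocV X Y Z ∘ assoc X Y Z = idm ((X ⊗ Y) ⊗ Z);
  assocVK : forall X Y Z, assoc X Y Z ∘ assocV X Y Z = idm (X ⊗ (Y ⊗ Z));
  lunitK : forall X, lunitV X ∘ lunit X = idm (unit_ob ⊗ X);
  lunitVK : forall X, lunit X ∘ lunitV X = idm X;
  runitK : forall X, runitV X ∘ runit X = idm (X ⊗ unit_ob);
  runitVK : forall X, runit X ∘ runitV X = idm X;
  assoc_nat : forall X X' Y Y' Z Z' (f : X ~> X') (g : Y ~> Y') (h : Z ~> Z'),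
    assoc X' Y' Z' ∘ ((f ⊗₁ g) ⊗₁ h) = (f ⊗₁ (g ⊗₁ h)) ∘ assoc X Y Z;
  lunit_nat : forall X Y (f : X ~> Y),
    lunit Y ∘ (idm unit_ob ⊗₁ f) = f ∘ lunit X;
  runit_nat : forall X Y (f : X ~> Y),
    runit Y ∘ (f ⊗₁ idm unit_ob) = f ∘ runit X;
  pentagon : forall X Y Z T,
    assoc X Y (Z ⊗ T) ∘ assoc (X ⊗ Y) Z T =
    (idm X ⊗₁ assoc Y Z T) ∘ assoc X (Y ⊗ Z) T ∘ (assoc X Y Z ⊗₁ idm T);
  triangle : forall X Y,
    (idm X ⊗₁ lunit Y) ∘ assoc X unit_ob Y = runit X ⊗₁ idm Y
}.

Arguments Hom {m} X Y.
Arguments idm {m} X.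
Arguments compm {m X Y Z} g f.
Arguments tensor {m} X Y.
Arguments tensorm {m X X' Y Y'} f g.
Arguments unit_ob {m}.
Arguments assoc {m} X Y Z.
Arguments assocV {m} X Y Z.
Arguments lunit {m} X.
Arguments lunitV {m} X.
Arguments runit {m} X.
Arguments runitV {m} X.

Notation "X ~> Y" := (Hom X Y) : moncat_scope.
Notation "g ∘ f" := (compm g f) : moncat_scope.
Notation "X ⊗ Y" := (tensor X Y) : moncat_scope.
Notation "f ⊗₁ g" := (tensorm f g) : moncat_scope.

Definition is_iso (M : moncat) (X Y : M) (f : X ~> Y) : Prop :=
  exists g : Y ~> X, g ∘ f = idm X /\ f ∘ g = idm Y.

Definition is_initial (M : moncat) (X : M) : Prop :=
  forall Y : M, exists! f : X ~> Y, True.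

(* If [M] has no initial object, both sides are always false, so that [M] is a
   domain, in accordance with the usual convention. *)
Definition is_domain (M : moncat) : Prop :=
  forall X Y : M, is_initial (X ⊗ Y) <-> is_initial X \/ is_initial Y.

(* The mediating morphism is part of the structure; as it is unique, this is
   the usual universal property. *)
Record coproduct (M : moncat) (I : Type) (X : I -> M) (P : M)
    (inj : forall i, X i ~> P) := Coproduct {
  cotuple : forall Y : M, (forall i, X i ~> Y) -> P ~> Y;
  cotuple_inj : forall (Y : M) (f : forall i, X i ~> Y) i,
    cotuple f ∘ inj i = f i;
  cotuple_uniq : forall (Y : M) (f : forall i, X i ~> Y) (h : P ~> Y),
    (forall i, h ∘ inj i = f i) -> h = cotuple f
}.

Record distributive (M : moncat) (S : Type) := Distributive {
  bigsum : (S -> M) -> M;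
  inj : forall (X : S -> M) i, X i ~> bigsum X;
  bigsum_coproduct : forall X : S -> M, coproduct (inj X);
  bigsum_tensorl : forall (X : M) (Y : S -> M),
    coproduct (fun i => idm X ⊗₁ inj Y i);
  bigsum_tensorr : forall (X : S -> M) (Y : M),
    coproduct (fun i => inj X i ⊗₁ idm Y)
}.

Arguments bigsum {M S} d X.
Arguments inj {M S} d X i.

Section Cotuples.
Variables (M : moncat) (S : Type) (D : distributive M S).

Definition bigsum_cotuple (X : S -> M) (Z : M) (f : forall i, X i ~> Z) :
    bigsum D X ~> Z :=
  cotuple (bigsum_coproduct D X) f.

Definition bigsum_cotuple2 (X Y : S -> M) (Z : M)
    (f : forall i j, X i ⊗ Y j ~> Z) : bigsum D X ⊗ bigsum D Y ~> Z :=
  cotuple (bigsum_tensorr D X (bigsum D Y))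
    (fun i => cotuple (bigsum_tensorl D (X i) Y) (f i)).

Lemma bigsum_cotuple2P (X Y : S -> M) (Z : M)
    (f : forall i j, X i ⊗ Y j ~> Z) (h : bigsum D X ⊗ bigsum D Y ~> Z) :
  (forall i j, h ∘ (inj D X i ⊗₁ inj D Y j) = f i j) <->
  h = bigsum_cotuple2 f.
Proof.
have split_inj i j : inj D X i ⊗₁ inj D Y j =
    (inj D X i ⊗₁ idm (bigsum D Y)) ∘ (idm (X i) ⊗₁ inj D Y j).
  by rewrite -tensor_comp comp_idl comp_idr.
split=> [hE|-> i j].
  apply: cotuple_uniq => i; apply: cotuple_uniq => j.
  by rewrite -comp_assoc -split_inj.
rewrite split_inj comp_assoc /bigsum_cotuple2.
by rewrite (cotuple_inj (bigsum_tensorr D X _)) (cotuple_inj (bigsum_tensorl D _ Y)).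
Qed.

End Cotuples.

(* [mhom A x y] is ${}_xA_y$, i.e. it plays the role of Hom(y, x). *)
Record mcat_data (M : moncat) (S : Type) := MCatData {
  mhom :> S -> S -> M;
  mcomp : forall x y z, mhom x y ⊗ mhom y z ~> mhom x z;
  mid : forall x, unit_ob ~> mhom x x
}.

Arguments mcomp {M S} m x y z.
Arguments mid {M S} m x.

Record is_mcategory (M : moncat) (S : Type) (A : mcat_data M S) : Prop :=
  IsMCategory {
    mcomp_assoc : forall x y z t,
      mcomp A x z t ∘ (mcomp A x y z ⊗₁ idm (A z t)) =
      mcomp A x y t ∘ (idm (A x y) ⊗₁ mcomp A y z t)
        ∘ assoc (A x y) (A y z) (A z t);
    mcomp_idl : forall x y,
      mcomp A x x y ∘ (mid A x ⊗₁ idm (A x y)) = lunit (A x y);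
    mcomp_idr : forall x y,
      mcomp A x y y ∘ (idm (A x y) ⊗₁ mid A y) = runit (A x y)
  }.

Record mcategory (M : moncat) (S : Type) := MCategory {
  mcategory_data :> mcat_data M S;
  mcategoryP : is_mcategory mcategory_data
}.

Record is_mfunctor (M : moncat) (S : Type) (A C : mcat_data M S)
    (F : forall x y, A x y ~> C x y) : Prop := IsMFunctor {
  mfunctor_id : forall x, F x x ∘ mid A x = mid C x;
  mfunctor_comp : forall x y z,
    mcomp C x y z ∘ (F x y ⊗₁ F y z) = F x z ∘ mcomp A x y z
}.

(* Identification of the codomains [X u] and [X v] when [u = v]. *)
Definition castcod (M : moncat) (S : Type) (X : S -> M) (Z : M) (u v : S)
    (e : u = v) (f : Z ~> X u) : Z ~> X v :=
  eq_rect u (fun w => Z ~> X w) f v e.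

Arguments castcod {M S} X {Z u v} e f.

Section SimpleTwistingSystem.
Variables (M : moncat) (S : Type) (A B : mcat_data M S).
(* [br x y z] is $|xyz|$, and [R x y z] is ${}_x\widetilde{R}_z^y$. *)
Variables (br : S -> S -> S -> S)
  (R : forall x y z,
    B x y ⊗ A y z ~> A x (br x y z) ⊗ B (br x y z) z).

Definition twist_compl x y z t :
    B x y ⊗ (B y z ⊗ A z t) ~>
    A x (br x y (br y z t)) ⊗ B (br x y (br y z t)) t :=
  let p := br y z t in let q := br x y p in
  (idm (A x q) ⊗₁ mcomp B q p t)
    ∘ assoc (A x q) (B q p) (B p t)
    ∘ (R x y p ⊗₁ idm (B p t))
    ∘ assocV (B x y) (A y p) (B p t)
    ∘ (idm (B x y) ⊗₁ R y z t).

Definition twist_compr x y z t :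
    (B x y ⊗ A y z) ⊗ A z t ~>
    A x (br (br x y z) z t) ⊗ B (br (br x y z) z t) t :=
  let p := br x y z in let q := br p z t in
  (mcomp A x p q ⊗₁ idm (B q t))
    ∘ assocV (A x p) (A p q) (B q t)
    ∘ (idm (A x p) ⊗₁ R p z t)
    ∘ assoc (A x p) (B p z) (A z t)
    ∘ (R x y z ⊗₁ idm (A z t)).

Record simple_twisting_system : Prop := SimpleTwistingSystem {
  twist_mcompB : forall x y z t,
    ~ is_initial (B x y ⊗ (B y z ⊗ A z t)) ->
    exists e : br x y (br y z t) = br x z t,
      castcod (fun w => A x w ⊗ B w t) e (twist_compl x y z t) =
      R x z t ∘ (mcomp B x y z ⊗₁ idm (A z t))
        ∘ assocV (B x y) (B y z) (A z t);
  twist_mcompA : forall x y z t,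
    ~ is_initial ((B x y ⊗ A y z) ⊗ A z t) ->
    exists e : br (br x y z) z t = br x y t,
      castcod (fun w => A x w ⊗ B w t) e (twist_compr x y z t) =
      R x y t ∘ (idm (B x y) ⊗₁ mcomp A y z t)
        ∘ assoc (B x y) (A y z) (A z t);
  twist_midB : forall x y,
    ~ is_initial (A x y) ->
    exists e : br x x y = y,
      castcod (fun w => A x w ⊗ B w y) e
        (R x x y ∘ (mid B x ⊗₁ idm (A x y))) =
      (idm (A x y) ⊗₁ mid B y) ∘ runitV (A x y) ∘ lunit (A x y);
  twist_midA : forall x y,
    ~ is_initial (B x y) ->
    exists e : br x y y = x,
      castcod (fun w => A x w ⊗ B w y) e
        (R x y y ∘ (idm (B x y) ⊗₁ mid A y)) =
      (mid A x ⊗₁ idm (B x y)) ∘ lunitV (B x y) ∘ runit (B x y);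
  twist_non_initial : forall x y z,
    ~ is_initial (B x y ⊗ A y z) ->
    ~ is_initial (A x (br x y z) ⊗ B (br x y z) z)
}.

Variable D : distributive M S.

Definition twisted_hom x y : M := bigsum D (fun u => A x u ⊗ B u y).

Definition twisted_inj x y u : A x u ⊗ B u y ~> twisted_hom x y :=
  inj D (fun u => A x u ⊗ B u y) u.

Definition twisted_comp_summand x y z u v :
    (A x u ⊗ B u y) ⊗ (A y v ⊗ B v z) ~> twisted_hom x z :=
  let p := br u y v in
  twisted_inj x z p
    ∘ (mcomp A x u p ⊗₁ mcomp B p v z)
    ∘ assocV (A x u) (A u p) (B p v ⊗ B v z)
    ∘ (idm (A x u) ⊗₁ assoc (A u p) (B p v) (B v z))
    ∘ (idm (A x u) ⊗₁ (R u y v ⊗₁ idm (B v z)))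
    ∘ (idm (A x u) ⊗₁ assocV (B u y) (A y v) (B v z))
    ∘ assoc (A x u) (B u y) (A y v ⊗ B v z).

(* By [bigsum_cotuple2P] this is the unique morphism [c] such that
   [c ∘ (twisted_inj x y u ⊗₁ twisted_inj y z v) =
    twisted_comp_summand x y z u v] for all [u] and [v]. *)
Definition twisted_comp x y z :
    twisted_hom x y ⊗ twisted_hom y z ~> twisted_hom x z :=
  bigsum_cotuple2 D (twisted_comp_summand x y z).

Definition twisted_id x : unit_ob ~> twisted_hom x x :=
  twisted_inj x x x ∘ (mid A x ⊗₁ mid B x) ∘ lunitV unit_ob.

Definition twisted_tensor : mcat_data M S :=
  MCatData twisted_comp twisted_id.

Definition twisted_alpha x y : A x y ~> twisted_tensor x y :=
  twisted_inj x y y ∘ (idm (A x y) ⊗₁ mid B y) ∘ runitV (A x y).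

Definition twisted_beta x y : B x y ~> twisted_tensor x y :=
  twisted_inj x y x ∘ (mid A x ⊗₁ idm (B x y)) ∘ lunitV (B x y).

End SimpleTwistingSystem.

Section Factorization.
Variables (M : moncat) (S : Type) (D : distributive M S).
Variables (A B C : mcat_data M S).
Variables (alpha : forall x y, A x y ~> C x y)
  (beta : forall x y, B x y ~> C x y).

Definition factor_map x y : bigsum D (fun u => A x u ⊗ B u y) ~> C x y :=
  bigsum_cotuple D (fun u => mcomp C x u y ∘ (alpha x u ⊗₁ beta u y)).

Definition factorizes : Prop := forall x y, is_iso (factor_map x y).

End Factorization.

(* Main.v *)
(* Associativity and unit constraints disappear once every morphism is replaced
   by its right whiskerings, regarded as maps between right-nested products
   X1 ⊗ (X2 ⊗ (... ⊗ T)) natural in T. In this form the composition of the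
   twisted tensor product is a ∘ b ∘ R, and its axioms follow from those of the
   twisting system. The latter hold only on non-initial objects: if the source of
   an equation is initial the equation is trivial, and otherwise, M being a
   domain, all tensor factors are non-initial. The map comparing the twisted
   tensor product with itself is the identity, as α ⊗ β composes to the
   inclusion of the summand A x u ⊗ B u y; here A u u is non-initial because
   A x u is a retract of A x u ⊗ A u u. *)
From mathcomp Require Import ssreflect ssrfun ssrbool.
From Stdlib Require Import Classical.
Require Import Defs.

Set Implicit Arguments.
Unset Strict Implicit.
Unset Printing Implicit Defensive.

Local Open Scope moncat_scope.

Local Notation "X ◁ f" := (idm X ⊗₁ f)
  (at level 38, right associativity) : moncat_scope.

(** * Monoidal coherence and actions on right-nested products *)

Section Monoidal.
Variable M : moncat.
Implicit Types X Y Z W T : M.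

(** In a left-nested composite [k ∘ g ∘ f] the pair [g ∘ f] is not a subterm; this form lets an
    equation about it be used for rewriting there. *)
Lemma comp_eq X Y Z W (f : X ~> Y) (g : Y ~> Z) (h : X ~> Z) :
  g ∘ f = h -> forall k : Z ~> W, k ∘ g ∘ f = k ∘ h.
Proof. by move=> <- k; rewrite comp_assoc. Qed.

Lemma whisker_comp X Y Z W (f : X ~> Y) (g : Y ~> Z) :
  W ◁ g ∘ W ◁ f = W ◁ (g ∘ f).
Proof. by rewrite -tensor_comp comp_idl. Qed.

Lemma comp_eq3 X Y Y' Z W (f : X ~> Y) (f' : Y ~> Y') (g : Y' ~> Z)
    (h : X ~> Z) :
  g ∘ f' ∘ f = h -> forall k : Z ~> W, k ∘ g ∘ f' ∘ f = k ∘ h.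
Proof. by move=> <- k; rewrite !comp_assoc. Qed.

Lemma whisker_eq W X Y Y' Z (f : X ~> Y) (g : Y ~> Z) (f' : X ~> Y')
    (g' : Y' ~> Z) :
  g ∘ f = g' ∘ f' -> W ◁ g ∘ W ◁ f = W ◁ g' ∘ W ◁ f'.
Proof. by rewrite !whisker_comp => ->. Qed.

Lemma comp_tensor_id X Y Z T (f : X ~> Y) (g : Y ~> Z) :
  (g ∘ f) ⊗₁ idm T = (g ⊗₁ idm T) ∘ (f ⊗₁ idm T).
Proof. by rewrite -tensor_comp comp_idl. Qed.

Lemma interchange X X' Y Y' (f : X ~> X') (g : Y ~> Y') :
  (f ⊗₁ idm Y') ∘ X ◁ g = X' ◁ g ∘ (f ⊗₁ idm Y).
Proof. by rewrite -!tensor_comp !comp_idl !comp_idr. Qed.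

Lemma retract_epi X Y Z (r : X ~> Y) (s : Y ~> X) (f g : Y ~> Z) :
  r ∘ s = idm Y -> f ∘ r = g ∘ r -> f = g.
Proof.
by move=> rs fg; rewrite -[f]comp_idr -[g]comp_idr -rs !comp_assoc fg.
Qed.

Lemma retract_mono X Y Z (r : X ~> Y) (s : Y ~> X) (f g : Z ~> X) :
  s ∘ r = idm X -> r ∘ f = r ∘ g -> f = g.
Proof.
by move=> sr fg; rewrite -[f]comp_idl -[g]comp_idl -sr -!comp_assoc fg.
Qed.

(** Whiskering by the unit object is already faithful, since [runit] is a natural isomorphism. This
    is what allows a return from whiskerings to morphisms. *)
Lemma tensor_id_inj X Y (f g : X ~> Y) :
  (forall T, f ⊗₁ idm T = g ⊗₁ idm T) -> f = g.
Proof.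
move=> fg; apply: (retract_epi (runitVK X)).
by rewrite -!runit_nat fg.
Qed.

Lemma unit_tensor_inj X Y (f g : X ~> Y) :
  unit_ob ◁ f = unit_ob ◁ g -> f = g.
Proof.
move=> fg; apply: (retract_epi (lunitVK X)).
by rewrite -!lunit_nat fg.
Qed.

Lemma assocV_nat X X' Y Y' Z Z' (f : X ~> X') (g : Y ~> Y') (h : Z ~> Z') :
  assocV X' Y' Z' ∘ (f ⊗₁ (g ⊗₁ h)) = ((f ⊗₁ g) ⊗₁ h) ∘ assocV X Y Z.
Proof.
apply: (retract_epi (assocVK X Y Z)).
by rewrite -!comp_assoc assocK comp_idr -assoc_nat comp_assoc assocK comp_idl.
Qed.

Lemma lunitV_nat X Y (f : X ~> Y) : lunitV Y ∘ f = unit_ob ◁ f ∘ lunitV X.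
Proof.
apply: (retract_epi (lunitVK X)).
by rewrite -!comp_assoc lunitK comp_idr -lunit_nat comp_assoc lunitK comp_idl.
Qed.

Lemma pentagonV X Y Z T :
  assoc X Y (Z ⊗ T) ∘ assoc (X ⊗ Y) Z T ∘ (assocV X Y Z ⊗₁ idm T) =
  X ◁ assoc Y Z T ∘ assoc X (Y ⊗ Z) T.
Proof.
by rewrite pentagon -!comp_assoc -comp_tensor_id assocVK tensor_id comp_idr.
Qed.

(** Kelly's argument: tensoring with the unit on the left is faithful, and after that and
    precomposition with associators the identity follows from pentagon and triangle. *)
Lemma lunit_tensor X Y : lunit (X ⊗ Y) ∘ assoc unit_ob X Y = lunit X ⊗₁ idm Y.
Proof.
apply: unit_tensor_inj; rewrite -whisker_comp.
apply: (retract_epi (assocVK _ _ _)); rewrite -assoc_nat.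
apply: (@retract_epi _ _ _ (assoc unit_ob unit_ob X ⊗₁ idm Y)
  (assocV unit_ob unit_ob X ⊗₁ idm Y)).
  by rewrite -comp_tensor_id assocVK tensor_id.
rewrite -!comp_assoc -comp_tensor_id triangle !comp_assoc.
rewrite assoc_nat tensor_id -triangle -!comp_assoc; congr compm.
by rewrite comp_assoc pentagon.
Qed.

Lemma lunitV_tensor X Y :
  assoc unit_ob X Y ∘ (lunitV X ⊗₁ idm Y) = lunitV (X ⊗ Y).
Proof.
apply: (retract_mono (lunitK _)).
by rewrite lunitVK comp_assoc lunit_tensor -comp_tensor_id lunitVK tensor_id.
Qed.

(* The actions below replace a morphism by the family of its right whiskerings
   by [T], between right-nested products ending in [T]; these are closed under
   composition and whiskering without any associativity or unit constraint.
   They are locked because rewriting with [comp_assoc] would unfold them. *)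
Definition act_unit X (e : unit_ob ~> X) T : T ~> X ⊗ T :=
  locked ((e ⊗₁ idm T) ∘ lunitV T).

Definition act_mul X Y Z (m : X ⊗ Y ~> Z) T : X ⊗ (Y ⊗ T) ~> Z ⊗ T :=
  locked ((m ⊗₁ idm T) ∘ assocV X Y T).

Definition act_twist X Y Z W (r : X ⊗ Y ~> Z ⊗ W) T :
    X ⊗ (Y ⊗ T) ~> Z ⊗ (W ⊗ T) :=
  locked (assoc Z W T ∘ act_mul r T).

Lemma act_unitE X (e : unit_ob ~> X) T :
  e ⊗₁ idm T = act_unit e T ∘ lunit T.
Proof. by rewrite /act_unit -lock -comp_assoc lunitK comp_idr. Qed.

Lemma act_mulE X Y Z (m : X ⊗ Y ~> Z) T :
  m ⊗₁ idm T = act_mul m T ∘ assoc X Y T.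
Proof. by rewrite /act_mul -lock -comp_assoc assocK comp_idr. Qed.

Lemma act_twistE X Y Z W (r : X ⊗ Y ~> Z ⊗ W) T :
  assoc Z W T ∘ (r ⊗₁ idm T) = act_twist r T ∘ assoc X Y T.
Proof. by rewrite /act_twist -lock act_mulE comp_assoc. Qed.

Lemma act_unit_nat X (e : unit_ob ~> X) T T' (f : T ~> T') :
  act_unit e T' ∘ f = X ◁ f ∘ act_unit e T.
Proof.
by rewrite /act_unit -!lock -comp_assoc lunitV_nat !comp_assoc interchange.
Qed.

Lemma act_mul_nat X Y Z (m : X ⊗ Y ~> Z) T T' (f : T ~> T') :
  act_mul m T' ∘ X ◁ Y ◁ f = Z ◁ f ∘ act_mul m T.
Proof.
rewrite /act_mul -!lock.
by rewrite -comp_assoc assocV_nat tensor_id !comp_assoc interchange.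
Qed.

Lemma act_twist_nat X Y Z W (r : X ⊗ Y ~> Z ⊗ W) T T' (f : T ~> T') :
  act_twist r T' ∘ X ◁ Y ◁ f = Z ◁ W ◁ f ∘ act_twist r T.
Proof.
rewrite /act_twist -!lock.
by rewrite -comp_assoc act_mul_nat !comp_assoc -assoc_nat tensor_id.
Qed.

Lemma assoc_whisker X Y Y' T (f : Y ~> Y') :
  assoc X Y' T ∘ ((X ◁ f) ⊗₁ idm T) = X ◁ (f ⊗₁ idm T) ∘ assoc X Y T.
Proof. exact: assoc_nat. Qed.

Lemma assoc_whiskerr X X' Y T (f : X ~> X') :
  assoc X' Y T ∘ ((f ⊗₁ idm Y) ⊗₁ idm T) = (f ⊗₁ idm (Y ⊗ T)) ∘ assoc X Y T.
Proof. by rewrite assoc_nat tensor_id. Qed.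

Lemma assoc_whiskerl X Y T T' (f : T ~> T') :
  assoc X Y T' ∘ (X ⊗ Y) ◁ f = X ◁ Y ◁ f ∘ assoc X Y T.
Proof. by rewrite -tensor_id assoc_nat. Qed.

(** Whiskering the two sides of the first equation by [T] gives the two sides of the second, each
    preceded by the same isomorphism. The two unit laws below are treated in the same way. *)
Lemma act_mul_assoc X Y Z XY YZ W (m : XY ⊗ Z ~> W) (m' : X ⊗ Y ~> XY)
    (n : X ⊗ YZ ~> W) (n' : Y ⊗ Z ~> YZ) :
  m ∘ (m' ⊗₁ idm Z) = n ∘ X ◁ n' ∘ assoc X Y Z <->
  forall T, act_mul m T ∘ act_mul m' (Z ⊗ T) = act_mul n T ∘ X ◁ act_mul n' T.
Proof.
have L T : (m ∘ (m' ⊗₁ idm Z)) ⊗₁ idm T =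
    act_mul m T ∘ act_mul m' (Z ⊗ T) ∘ (assoc X Y (Z ⊗ T) ∘ assoc (X ⊗ Y) Z T).
  rewrite comp_tensor_id act_mulE -comp_assoc assoc_whiskerr.
  by rewrite (act_mulE m') !comp_assoc.
have R T : (n ∘ X ◁ n' ∘ assoc X Y Z) ⊗₁ idm T =
    act_mul n T ∘ X ◁ act_mul n' T ∘ (assoc X Y (Z ⊗ T) ∘ assoc (X ⊗ Y) Z T).
  rewrite !comp_tensor_id act_mulE (comp_eq (assoc_whisker _ _ _)).
  by rewrite (act_mulE n') pentagon !comp_assoc (comp_eq (whisker_comp _ _ _)).
split=> [mn T|mn].
  move: (R T); rewrite -mn L !comp_assoc => {}R.
  by apply: (retract_epi (assocVK _ _ _)); apply: (retract_epi (assocVK _ _ _)).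
by apply: tensor_id_inj => T; rewrite L R mn.
Qed.

Lemma act_mul_idl X Y (e : unit_ob ~> X) (m : X ⊗ Y ~> Y) :
  m ∘ (e ⊗₁ idm Y) = lunit Y <->
  forall T, act_mul m T ∘ act_unit e (Y ⊗ T) = idm (Y ⊗ T).
Proof.
have L T : (m ∘ (e ⊗₁ idm Y)) ⊗₁ idm T =
    act_mul m T ∘ act_unit e (Y ⊗ T) ∘ (lunit (Y ⊗ T) ∘ assoc unit_ob Y T).
  rewrite comp_tensor_id act_mulE -comp_assoc assoc_whiskerr.
  by rewrite act_unitE !comp_assoc.
split=> [me T|me].
  move: (L T); rewrite me -lunit_tensor => {}L.
  apply: (retract_epi (lunitVK _)); apply: (retract_epi (assocVK _ _ _)).
  by rewrite comp_idl -(comp_assoc _ (lunit _)) -L.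
by apply: tensor_id_inj => T; rewrite L me comp_idl lunit_tensor.
Qed.

Lemma act_mul_idr X Y (e : unit_ob ~> Y) (m : X ⊗ Y ~> X) :
  m ∘ X ◁ e = runit X <->
  forall T, act_mul m T ∘ X ◁ act_unit e T = idm (X ⊗ T).
Proof.
have L T : (m ∘ X ◁ e) ⊗₁ idm T =
    act_mul m T ∘ X ◁ act_unit e T ∘ (runit X ⊗₁ idm T).
  rewrite comp_tensor_id act_mulE -comp_assoc assoc_whisker.
  by rewrite act_unitE -whisker_comp -triangle !comp_assoc.
split=> [me T|me].
  apply: (@retract_epi _ _ _ (runit X ⊗₁ idm T) (runitV X ⊗₁ idm T)).
    by rewrite -comp_tensor_id runitVK tensor_id.
  by rewrite -L me comp_idl.
by apply: tensor_id_inj => T; rewrite L me comp_idl.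
Qed.

Lemma assoc_unit_tensor X Y T (e : unit_ob ~> X) :
  assoc X Y T ∘ ((e ⊗₁ idm Y) ⊗₁ idm T) =
  act_unit e (Y ⊗ T) ∘ (lunit Y ⊗₁ idm T).
Proof. by rewrite assoc_whiskerr act_unitE -comp_assoc lunit_tensor. Qed.

Lemma assoc_tensor_unit X Y T (e : unit_ob ~> Y) :
  assoc X Y T ∘ ((X ◁ e) ⊗₁ idm T) = X ◁ act_unit e T ∘ (runit X ⊗₁ idm T).
Proof.
by rewrite assoc_whisker act_unitE -whisker_comp -comp_assoc triangle.
Qed.

Lemma comp_pentagon X Y Z T W (k : X ⊗ (Y ⊗ (Z ⊗ T)) ~> W) :
  k ∘ X ◁ assoc Y Z T ∘ assoc X (Y ⊗ Z) T ∘ (assoc X Y Z ⊗₁ idm T) =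
  k ∘ assoc X Y (Z ⊗ T) ∘ assoc (X ⊗ Y) Z T.
Proof.
by rewrite -2!(comp_assoc _ _ k) -(comp_assoc _ _ k) pentagon -!comp_assoc.
Qed.

Lemma comp_pentagonV X Y Z T W (k : X ⊗ (Y ⊗ (Z ⊗ T)) ~> W) :
  k ∘ assoc X Y (Z ⊗ T) ∘ assoc (X ⊗ Y) Z T ∘ (assocV X Y Z ⊗₁ idm T) =
  k ∘ X ◁ assoc Y Z T ∘ assoc X (Y ⊗ Z) T.
Proof. by rewrite -!comp_assoc (comp_assoc _ _ (assoc _ _ _)) pentagonV. Qed.

(** A twist followed by a multiplication on its right, as in [twist_compl] and the inner part of
    [twisted_comp_summand]. The next lemma treats multiplication on the left, as in [twist_compr]
    and the outer part of the summand. *)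
Lemma act_twist_mulr X Y Z W V V' (r : X ⊗ Y ~> Z ⊗ W) (m : W ⊗ V ~> V') T :
  act_twist (Z ◁ m ∘ assoc Z W V ∘ (r ⊗₁ idm V) ∘ assocV X Y V) T =
  Z ◁ act_mul m T ∘ act_twist r (V ⊗ T) ∘ X ◁ assoc Y V T.
Proof.
apply: (retract_epi (assocVK _ _ _)).
rewrite -act_twistE !comp_tensor_id !comp_assoc.
rewrite assoc_whisker act_mulE -whisker_comp comp_pentagon.
rewrite (comp_eq (assoc_whiskerr _ _ _)) !comp_assoc.
by rewrite (comp_eq (act_twistE r _)) !comp_assoc comp_pentagonV.
Qed.

Lemma act_twist_mull U U' X Y Z W (r : X ⊗ Y ~> Z ⊗ W) (m : U ⊗ Z ~> U') T :
  act_twist ((m ⊗₁ idm W) ∘ assocV U Z W ∘ U ◁ r ∘ assoc U X Y) T =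
  act_mul m (W ⊗ T) ∘ U ◁ act_twist r T ∘ assoc U X (Y ⊗ T).
Proof.
apply: (retract_epi (assocVK _ _ _)).
rewrite -act_twistE !comp_tensor_id !comp_assoc.
rewrite assoc_whiskerr act_mulE comp_pentagonV.
rewrite (comp_eq (assoc_whisker _ _ _)) !comp_assoc.
rewrite (comp_eq (whisker_comp _ _ _)) act_twistE -whisker_comp !comp_assoc.
by rewrite comp_pentagon.
Qed.

Lemma act_mul_tensor X X' Y Y' Z (m : X' ⊗ Y' ~> Z) (f : X ~> X') (g : Y ~> Y')
    T :
  (m ∘ (f ⊗₁ g)) ⊗₁ idm T =
  act_mul m T ∘ (f ⊗₁ idm (Y' ⊗ T)) ∘ X ◁ (g ⊗₁ idm T) ∘ assoc X Y T.
Proof.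
rewrite comp_tensor_id act_mulE -comp_assoc assoc_nat !comp_assoc.
by rewrite (comp_eq (esym (tensor_comp _ _ _ _))) comp_idl comp_idr.
Qed.

End Monoidal.

(** * Initial objects in a monoidal domain *)

Section Initial.
Variables (M : moncat) (domM : is_domain M).

Lemma initial_eq (X Y : M) (f g : X ~> Y) : is_initial X -> f = g.
Proof. by move=> /(_ Y)[h [_ hP]]; rewrite -(hP f I) -(hP g I). Qed.

Lemma initial_retract (X Y : M) (r : X ~> Y) (s : Y ~> X) :
  r ∘ s = idm Y -> is_initial X -> is_initial Y.
Proof.
move=> rs X0 Z; have [h _] := X0 Z; exists (h ∘ s); split=> // f _.
by apply: (retract_epi rs); apply: initial_eq.
Qed.

Lemma noninitial_tensor (X Y : M) :
  ~ is_initial (X ⊗ Y) <-> ~ is_initial X /\ ~ is_initial Y.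
Proof. have := domM X Y; tauto. Qed.

(** Supplies, by a classical case distinction, the non-initiality hypotheses under which the
    twisting axioms can be applied. *)
Lemma initial_tensor_eq (X Y Z : M) (f g : X ⊗ Y ~> Z) :
  (~ is_initial X -> ~ is_initial Y -> f = g) -> f = g.
Proof.
move=> fg; have [XY0|] := classic (is_initial (X ⊗ Y)).
  exact: initial_eq.
by move/noninitial_tensor => -[]; exact: fg.
Qed.

Lemma noninitial_endo (S : Type) (A : mcategory M S) x y :
  ~ is_initial (A x y) -> ~ is_initial (A y y).
Proof.
move=> nAxy Ayy; apply: nAxy.
apply: (@initial_retract (A x y ⊗ A y y) _ (mcomp A x y y)
  (A x y ◁ mid A y ∘ runitV (A x y))).
  by rewrite comp_assoc (mcomp_idr (mcategoryP A)) runitVK.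
by apply/domM; right.
Qed.

End Initial.

(** * Testing equations on the summands of a distributive coproduct *)

Section Covers.
Variables (M : moncat) (S : Type) (D : distributive M S).

Lemma coproduct_epi (X : S -> M) (P Z : M) (e : forall i, X i ~> P)
    (f g : P ~> Z) :
  coproduct e -> (forall i, f ∘ e i = g ∘ e i) -> f = g.
Proof.
move=> cop fg; rewrite (cotuple_uniq cop fg).
by rewrite -(@cotuple_uniq _ _ _ _ _ cop _ _ g).
Qed.

Lemma bigsum_cotuple_inj (X : S -> M) (Z : M) (f : forall i, X i ~> Z) i :
  bigsum_cotuple D f ∘ inj D X i = f i.
Proof. exact: cotuple_inj. Qed.

(* Unlike being jointly epimorphic, this is preserved by [X ⊗ -]. *)
Definition split_cover (X : S -> M) (P : M) (e : forall i, X i ~> P) : Prop :=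
  exists r : P ~> bigsum D X, bigsum_cotuple D e ∘ r = idm P.

Lemma split_cover_epi (X : S -> M) (P Z : M) (e : forall i, X i ~> P)
    (f g : P ~> Z) :
  split_cover e -> (forall i, f ∘ e i = g ∘ e i) -> f = g.
Proof.
move=> [r rP] fg; apply: (retract_epi rP).
apply: (coproduct_epi (bigsum_coproduct D X)) => i.
by rewrite -!comp_assoc bigsum_cotuple_inj.
Qed.

Lemma coproduct_split_cover (X : S -> M) (P : M) (e : forall i, X i ~> P) :
  coproduct e -> split_cover e.
Proof.
move=> cop; exists (cotuple cop (inj D X)); apply: (coproduct_epi cop) => i.
by rewrite -comp_assoc cotuple_inj bigsum_cotuple_inj comp_idl.
Qed.

(** By left distributivity the whiskered section [Y ◁ r] can be continued from [Y ⊗ bigsum D X] to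
    the coproduct of the [Y ⊗ X i]. *)
Lemma split_cover_whisker (X : S -> M) (P Y : M) (e : forall i, X i ~> P) :
  split_cover e -> split_cover (fun i => Y ◁ e i).
Proof.
move=> [r rP].
exists (cotuple (bigsum_tensorl D Y X) (inj D _) ∘ Y ◁ r).
rewrite comp_assoc -tensor_id -rP -whisker_comp; congr compm.
apply: (coproduct_epi (bigsum_tensorl D Y X)) => i.
by rewrite -comp_assoc whisker_comp (cotuple_inj (bigsum_tensorl D Y X))
  !bigsum_cotuple_inj.
Qed.

(** Right distributivity makes the injections whiskered by [T] a coproduct; the actions differ from
    them only by an associator on each summand. *)
Lemma act_inj_cover (X Y : S -> M) (T : M) :
  split_cover (fun i => act_mul (inj D (fun i => X i ⊗ Y i) i) T).
Proof.
apply: coproduct_split_cover; set cop := bigsum_tensorr D (fun i => X i ⊗ Y i) T.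
exists (fun Z f => cotuple cop (fun i => f i ∘ assoc (X i) (Y i) T)).
  move=> Z f i; apply: (retract_epi (assocVK _ _ _)).
  by rewrite -comp_assoc -act_mulE (cotuple_inj cop).
move=> Z f h hf; apply: (cotuple_uniq cop) => i.
by rewrite -hf -comp_assoc -act_mulE.
Qed.

End Covers.

(** * The twisting axioms as equations between actions *)

Section TwistActions.
Variables (M : moncat) (domM : is_domain M) (S : Type) (A B : mcat_data M S).
Variables (br : S -> S -> S -> S)
  (R : forall x y z, B x y ⊗ A y z ~> A x (br x y z) ⊗ B (br x y z) z).

Lemma act_twist_compl x y z t (T : M) :
  let p := br y z t in let q := br x y p in
  assoc (A x q) (B q t) T ∘ (twist_compl R x y z t ⊗₁ idm T) =
  A x q ◁ act_mul (mcomp B q p t) T ∘ act_twist (R x y p) (B p t ⊗ T)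
    ∘ B x y ◁ act_twist (R y z t) T
    ∘ B x y ◁ assoc (B y z) (A z t) T ∘ assoc (B x y) (B y z ⊗ A z t) T.
Proof.
move=> p q; rewrite comp_tensor_id comp_assoc act_twistE act_twist_mulr.
rewrite (comp_eq (assoc_whisker _ _ _)) !comp_assoc.
by rewrite !(comp_eq (whisker_comp _ _ _)) act_twistE.
Qed.

Lemma act_twist_compr x y z t (T : M) :
  let p := br x y z in let q := br p z t in
  assoc (A x q) (B q t) T ∘ (twist_compr R x y z t ⊗₁ idm T) =
  act_mul (mcomp A x p q) (B q t ⊗ T) ∘ A x p ◁ act_twist (R p z t) T
    ∘ act_twist (R x y z) (A z t ⊗ T)
    ∘ assoc (B x y) (A y z) (A z t ⊗ T) ∘ assoc (B x y ⊗ A y z) (A z t) T.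
Proof.
move=> p q; rewrite comp_tensor_id comp_assoc act_twistE act_twist_mull.
rewrite (comp_eq (assoc_whiskerr _ _ _)) !comp_assoc.
by rewrite (comp_eq (act_twistE (R _ _ _) _)) !comp_assoc.
Qed.

(** The shape of the conclusions of the twisting axioms. Hiding the proof of [u = v] lets both sides
    be transformed together without carrying the transport along. *)
Definition castcod_eq (X : S -> M) (Z : M) u v (f : Z ~> X u) (g : Z ~> X v) :=
  exists e : u = v, castcod X e f = g.

Lemma castcod_eq_comp (X X' : S -> M) (Z : M) u v (f : Z ~> X u) (g : Z ~> X v)
    (k : forall w, X w ~> X' w) :
  castcod_eq f g -> castcod_eq (X := X') (k u ∘ f) (k v ∘ g).
Proof.
by move=> [e]; case: _ / e g => g <-; exists (erefl u).
Qed.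

Lemma castcod_eq_tensor (X : S -> M) (Z T : M) u v (f : Z ~> X u)
    (g : Z ~> X v) :
  castcod_eq f g ->
  castcod_eq (X := fun w => X w ⊗ T) (f ⊗₁ idm T) (g ⊗₁ idm T).
Proof.
by move=> [e]; case: _ / e g => g <-; exists (erefl u).
Qed.

Lemma castcod_eq_epi (X : S -> M) (Z Z' : M) u v (f : Z ~> X u) (g : Z ~> X v)
    (r : Z' ~> Z) (s : Z ~> Z') :
  r ∘ s = idm Z ->
  castcod_eq (X := X) (f ∘ r) (g ∘ r) -> castcod_eq (X := X) f g.
Proof.
move=> rs [e]; case: _ / e g => g /(retract_epi rs) <-; by exists (erefl u).
Qed.

(* Composing with a family [k] indexed by all intermediate objects hides the
   transport along [u = v]. *)
Lemma castcod_eq_whisker (X : S -> M) (Z W Y : M) u v (f : Z ~> X u)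
    (g : Z ~> X v) (k : forall w, W ⊗ X w ~> Y) :
  castcod_eq f g -> k u ∘ W ◁ f = k v ∘ W ◁ g.
Proof. by move=> [e]; case: _ / e g => g <-. Qed.

Lemma castcod_eq_act x t (Z T : M) u v (f : Z ~> A x u ⊗ B u t)
    (g : Z ~> A x v ⊗ B v t) :
  castcod_eq (X := fun w => A x w ⊗ B w t) f g ->
  castcod_eq (X := fun w => A x w ⊗ (B w t ⊗ T))
    (assoc _ _ T ∘ (f ⊗₁ idm T)) (assoc _ _ T ∘ (g ⊗₁ idm T)).
Proof.
move=> /(castcod_eq_tensor T).
exact: (castcod_eq_comp (X' := fun w => A x w ⊗ (B w t ⊗ T))
  (fun w => assoc (A x w) (B w t) T)).
Qed.

Hypothesis twR : simple_twisting_system R.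

Lemma act_twist_mcompB x y z t (T : M) :
  let p := br y z t in let q := br x y p in
  ~ is_initial (B x y) -> ~ is_initial (B y z) -> ~ is_initial (A z t) ->
  castcod_eq (X := fun w => A x w ⊗ (B w t ⊗ T))
    (A x q ◁ act_mul (mcomp B q p t) T
      ∘ act_twist (R x y p) (B p t ⊗ T) ∘ B x y ◁ act_twist (R y z t) T)
    (act_twist (R x z t) T ∘ act_mul (mcomp B x y z) (A z t ⊗ T)).
Proof.
move=> p q Bxy Byz Azt.
have /(castcod_eq_act T) := twist_mcompB twR (x := x) (y := y) (z := z) (t := t)
  (proj2 (noninitial_tensor domM _ _)
    (conj Bxy (proj2 (noninitial_tensor domM _ _) (conj Byz Azt)))).
rewrite act_twist_compl !comp_tensor_id !comp_assoc act_twistE.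
rewrite (comp_eq (assoc_whiskerr _ _ _)) act_mulE !comp_assoc comp_pentagonV.
move=> /(castcod_eq_epi (assocVK _ _ _)).
(* With the outer associator cancelled, both sides still end in [B x y ◁ assoc (B y z) (A z t) T];
   introducing its inverse on the goal makes them agree with the axiom. *)
apply: (@castcod_eq_epi _ _ _ _ _ _ _ _ (B x y ◁ assocV (B y z) (A z t) T)).
by rewrite whisker_comp assocVK tensor_id.
Qed.

Lemma act_twist_mcompA x y z t (T : M) :
  let p := br x y z in let q := br p z t in
  ~ is_initial (B x y) -> ~ is_initial (A y z) -> ~ is_initial (A z t) ->
  castcod_eq (X := fun w => A x w ⊗ (B w t ⊗ T))
    (act_mul (mcomp A x p q) (B q t ⊗ T)
      ∘ A x p ◁ act_twist (R p z t) T ∘ act_twist (R x y z) (A z t ⊗ T))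
    (act_twist (R x y t) T ∘ B x y ◁ act_mul (mcomp A y z t) T).
Proof.
move=> p q Bxy Ayz Azt.
have /(castcod_eq_act T) := twist_mcompA twR (x := x) (y := y) (z := z) (t := t)
  (proj2 (noninitial_tensor domM _ _)
    (conj (proj2 (noninitial_tensor domM _ _) (conj Bxy Ayz)) Azt)).
rewrite act_twist_compr !comp_tensor_id !comp_assoc act_twistE.
rewrite (comp_eq (assoc_whisker _ _ _)) act_mulE -whisker_comp !comp_assoc.
rewrite comp_pentagon => /(castcod_eq_epi (assocVK _ _ _)).
exact: (castcod_eq_epi (assocVK _ _ _)).
Qed.

Lemma act_twist_midB x y (T : M) :
  ~ is_initial (A x y) ->
  castcod_eq (X := fun w => A x w ⊗ (B w y ⊗ T))
    (act_twist (R x x y) T ∘ act_unit (mid B x) (A x y ⊗ T))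
    (A x y ◁ act_unit (mid B y) T).
Proof.
move=> /(twist_midB twR)/(castcod_eq_act T).
rewrite !comp_tensor_id !comp_assoc act_twistE.
rewrite (comp_eq (assoc_unit_tensor _ _ _)) assoc_tensor_unit !comp_assoc.
rewrite (comp_eq (esym (comp_tensor_id _ (runitV _) _))) runitVK tensor_id.
rewrite comp_idr; apply: (@castcod_eq_epi _ _ _ _ _ _ _ _
  (lunitV (A x y) ⊗₁ idm T)).
by rewrite -comp_tensor_id lunitVK tensor_id.
Qed.

Lemma act_twist_midA x y (T : M) :
  ~ is_initial (B x y) ->
  castcod_eq (X := fun w => A x w ⊗ (B w y ⊗ T))
    (act_twist (R x y y) T ∘ B x y ◁ act_unit (mid A y) T)
    (act_unit (mid A x) (B x y ⊗ T)).
Proof.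
move=> /(twist_midA twR)/(castcod_eq_act T).
rewrite !comp_tensor_id !comp_assoc act_twistE.
rewrite (comp_eq (assoc_tensor_unit _ _ _)) assoc_unit_tensor !comp_assoc.
rewrite (comp_eq (esym (comp_tensor_id _ (lunitV _) _))) lunitVK tensor_id.
rewrite comp_idr; apply: (@castcod_eq_epi _ _ _ _ _ _ _ _
  (runitV (B x y) ⊗₁ idm T)).
by rewrite -comp_tensor_id runitVK tensor_id.
Qed.

End TwistActions.

(** * The twisted tensor product in terms of actions *)

Section TwistedTensor.
Variables (S : Type) (M : moncat) (D : distributive M S) (domM : is_domain M).
Variables (A B : mcategory M S) (br : S -> S -> S -> S)
  (R : forall x y z, B x y ⊗ A y z ~> A x (br x y z) ⊗ B (br x y z) z).
Hypothesis twR : simple_twisting_system R.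

Local Notation C := (twisted_tensor R D).
Local Notation sigma x y u := (act_mul (twisted_inj A B D x y u)).
Local Notation a x y z := (act_mul (mcomp A x y z)).
Local Notation b x y z := (act_mul (mcomp B x y z)).
Local Notation c x y z := (act_mul (mcomp C x y z)).
Local Notation r x y z := (act_twist (R x y z)).
Local Notation i x := (act_unit (mid A x)).
Local Notation j x := (act_unit (mid B x)).

Lemma act_mcompA x y z t T :
  a x z t T ∘ a x y z (A z t ⊗ T) = a x y t T ∘ A x y ◁ a y z t T.
Proof. by apply/act_mul_assoc: T; exact: (mcomp_assoc (mcategoryP A)). Qed.

Lemma act_mcompB x y z t T :
  b x z t T ∘ b x y z (B z t ⊗ T) = b x y t T ∘ B x y ◁ b y z t T.
Proof. by apply/act_mul_assoc: T; exact: (mcomp_assoc (mcategoryP B)). Qed.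

Lemma act_midAl x y T : a x x y T ∘ i x (A x y ⊗ T) = idm _.
Proof. by apply/act_mul_idl: T; exact: (mcomp_idl (mcategoryP A)). Qed.

Lemma act_midAr x y T : a x y y T ∘ A x y ◁ i y T = idm _.
Proof. by apply/act_mul_idr: T; exact: (mcomp_idr (mcategoryP A)). Qed.

Lemma act_midBl x y T : b x x y T ∘ j x (B x y ⊗ T) = idm _.
Proof. by apply/act_mul_idl: T; exact: (mcomp_idl (mcategoryP B)). Qed.

Lemma act_midBr x y T : b x y y T ∘ B x y ◁ j y T = idm _.
Proof. by apply/act_mul_idr: T; exact: (mcomp_idr (mcategoryP B)). Qed.

Lemma act_twisted_comp x y z u v T :
  c x y z T ∘ sigma x y u (C y z ⊗ T) ∘ A x u ◁ B u y ◁ sigma y z v T =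
  sigma x z (br u y v) T ∘ a x u (br u y v) (B (br u y v) z ⊗ T)
    ∘ A x u ◁ A u (br u y v) ◁ b (br u y v) v z T
    ∘ A x u ◁ r u y v (B v z ⊗ T).
Proof.
set p := br u y v.
have cE : twisted_comp R D x y z ∘
    (twisted_inj A B D x y u ⊗₁ twisted_inj A B D y z v) =
    twisted_comp_summand R D x y z u v.
  exact: (proj2 (bigsum_cotuple2P (twisted_comp_summand R D x y z)
    (twisted_comp R D x y z)) erefl u v).
(* The product [mcomp A ⊗₁ mcomp B] is split so that [mcomp B] acts first, which nests the shape of
   [act_twist_mulr] inside that of [act_twist_mull]. *)
have E : twisted_comp_summand R D x y z u v =
    twisted_inj A B D x z p ∘ ((mcomp A x u p ⊗₁ idm (B p z))
      ∘ assocV (A x u) (A u p) (B p z)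
      ∘ A x u ◁ (A u p ◁ mcomp B p v z ∘ assoc (A u p) (B p v) (B v z)
        ∘ (R u y v ⊗₁ idm (B v z)) ∘ assocV (B u y) (A y v) (B v z))
      ∘ assoc (A x u) (B u y) (A y v ⊗ B v z)).
  rewrite -!whisker_comp !comp_assoc (comp_eq (assocV_nat _ _ _)) tensor_id.
  rewrite !comp_assoc (comp_eq (esym (tensor_comp _ (mcomp A _ _ _) _ _))).
  by rewrite comp_idl comp_idr.
(* Precomposing with three associators turns the goal into the whiskering of [cE] by [T]. *)
apply: (@retract_epi _ _ _ _ (A x u ◁ B u y ◁ assoc (A y v) (B v z) T)
  (A x u ◁ B u y ◁ assocV (A y v) (B v z) T)).
  by rewrite !whisker_comp assocVK !tensor_id.
apply: (retract_epi (assocVK _ _ _)); apply: (retract_epi (assocVK _ _ _)).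
move/(congr1 (fun f => f ⊗₁ idm T)): cE.
rewrite act_mul_tensor !(act_mulE (twisted_inj _ _ _ _ _ _)) -!whisker_comp.
rewrite !comp_assoc (comp_eq (assoc_whiskerl _ _ _)) !comp_assoc.
rewrite (comp_eq (assoc_whiskerl _ _ _)) !comp_assoc => ->.
rewrite E comp_tensor_id act_mulE -comp_assoc act_twistE act_twist_mull.
by rewrite act_twist_mulr -!whisker_comp !comp_assoc.
Qed.

Lemma act_twisted_id x T :
  act_unit (mid C x) T = sigma x x x T ∘ i x (B x x ⊗ T) ∘ j x T.
Proof.
apply: (retract_epi (lunitVK _)).
rewrite -act_unitE /= /twisted_id !comp_tensor_id act_mulE.
rewrite -(comp_assoc _ _ (sigma _ _ _ _)) assoc_nat !comp_assoc.
(* The inserted identities separate the two units, so that [mid B x] can be moved across [lunitV] by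
   naturality. *)
rewrite (comp_eq (lunitV_tensor _ _)) -[mid A x]comp_idr -[mid B x ⊗₁ _]comp_idl.
rewrite tensor_comp !comp_assoc -(comp_assoc (lunitV _)) -lunitV_nat comp_idr.
rewrite !act_unitE !comp_assoc.
by rewrite (comp_eq (lunitVK _)) comp_idr.
Qed.

Lemma act_twisted_alpha x y T :
  twisted_alpha R D x y ⊗₁ idm T = sigma x y y T ∘ A x y ◁ j y T.
Proof.
rewrite /twisted_alpha !comp_tensor_id act_mulE.
rewrite (comp_eq (assoc_tensor_unit _ _ _)) !comp_assoc.
by rewrite (comp_eq (esym (comp_tensor_id _ _ _))) runitVK tensor_id comp_idr.
Qed.

Lemma act_twisted_beta x y T :
  twisted_beta R D x y ⊗₁ idm T = sigma x y x T ∘ i x (B x y ⊗ T).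
Proof.
rewrite /twisted_beta !comp_tensor_id act_mulE.
rewrite (comp_eq (assoc_unit_tensor _ _ _)) !comp_assoc.
by rewrite (comp_eq (esym (comp_tensor_id _ _ _))) lunitVK tensor_id comp_idr.
Qed.

(** * The category axioms *)

Lemma sigma_cover x y T : split_cover D (fun u => sigma x y u T).
Proof. exact: act_inj_cover. Qed.

(** On the summand [A x u ⊗ B u y], the axiom on [mid B] carries the unit [j x] past [A x u], where
    it becomes [j u]. The unit laws of [B] and [A] then absorb [j u] and [i x]. The right unit law
    is dual, with [mid A] carried past [B u y]. *)
Lemma twisted_comp_idl x y :
  mcomp C x x y ∘ (mid C x ⊗₁ idm (C x y)) = lunit (C x y).
Proof.
apply/act_mul_idl => T; apply: (split_cover_epi (sigma_cover x y T)) => u.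
apply: (initial_tensor_eq domM) => nA _.
rewrite comp_idl -comp_assoc act_unit_nat act_twisted_id !comp_assoc.
rewrite (comp_eq (esym (act_mul_nat _ _))) !comp_assoc act_twisted_comp.
rewrite (comp_eq (act_unit_nat _ (j x _))) !comp_assoc.
move: (castcod_eq_whisker (fun w => sigma x y w T ∘ a x x w (B w y ⊗ T)
  ∘ A x x ◁ A x w ◁ b w u y T) (act_twist_midB twR (B u y ⊗ T) nA)).
rewrite -whisker_comp !comp_assoc => ->.
rewrite (comp_eq (whisker_comp _ _ _)) whisker_comp act_midBl !tensor_id comp_idr.
by rewrite (comp_eq (act_midAl _ _ _)) comp_idr.
Qed.

Lemma twisted_comp_idr x y :
  mcomp C x y y ∘ C x y ◁ mid C y = runit (C x y).
Proof.
apply/act_mul_idr => T; apply: (split_cover_epi (sigma_cover x y T)) => u.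
apply: (initial_tensor_eq domM) => _ /(noninitial_tensor domM)[nB _].
rewrite comp_idl (comp_eq (esym (act_mul_nat _ _))).
rewrite act_twisted_id -!whisker_comp !comp_assoc act_twisted_comp.
move: (castcod_eq_whisker (fun w => sigma x y w T ∘ a x u w (B w y ⊗ T)
  ∘ A x u ◁ A u w ◁ b w y y T) (act_twist_midA twR (B y y ⊗ T) nB)).
rewrite -whisker_comp !comp_assoc => ->.
rewrite (comp_eq (whisker_comp _ _ _)) -act_unit_nat -whisker_comp !comp_assoc.
rewrite (comp_eq (act_midAr _ _ _)) comp_idr.
by rewrite (comp_eq (whisker_comp _ _ _)) act_midBr tensor_id comp_idr.
Qed.

(* With p = |uyv| and q = |vzw|, both sides pass through the intermediate object
   |pvq|: it equals |pzw| by the axiom on [mcomp B] and |uyq| by that on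
   [mcomp A]. *)
Lemma twisted_comp_assoc x y z t :
  mcomp C x z t ∘ (mcomp C x y z ⊗₁ idm (C z t)) =
  mcomp C x y t ∘ C x y ◁ mcomp C y z t ∘ assoc (C x y) (C y z) (C z t).
Proof.
apply/act_mul_assoc => T.
apply: (split_cover_epi (sigma_cover x y _)) => u.
apply: (split_cover_epi (split_cover_whisker _ (split_cover_whisker _
  (sigma_cover y z _)))) => v.
apply: (split_cover_epi (split_cover_whisker _ (split_cover_whisker _
  (split_cover_whisker _ (split_cover_whisker _ (sigma_cover z t T)))))) => w.
apply: (initial_tensor_eq domM) => _ /(noninitial_tensor domM)[Buy].
move=> /(noninitial_tensor domM)[Ayv] /(noninitial_tensor domM)[Bvz].
move=> /(noninitial_tensor domM)[Azw _].
(* The axioms will be applied to [B p v], [B v z], [A z w] and to [B u y], [A y v], [A v q]. The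
   factors [B p v] and [A v q] arise from twists, so only [twist_non_initial] shows that they are
   not initial. *)
have [_ Bpv] : ~ is_initial (A u (br u y v)) /\ ~ is_initial (B (br u y v) v).
  by apply/(noninitial_tensor domM)/(twist_non_initial twR);
    apply/(noninitial_tensor domM).
have [Avq _] : ~ is_initial (A v (br v z w)) /\ ~ is_initial (B (br v z w) w).
  by apply/(noninitial_tensor domM)/(twist_non_initial twR);
    apply/(noninitial_tensor domM).
(* The left side is unfolded first: the inclusion of the third factor is moved outwards until the
   outer composition can be expanded, and [b p v z] is brought next to [r p z w]. *)
rewrite (comp_eq3 (act_twisted_comp _ _ _ _ _ _)) !comp_assoc.
rewrite (comp_eq (whisker_eq _ (act_twist_nat _ _))) !comp_assoc.
rewrite (comp_eq (whisker_eq _ (whisker_eq _ (act_mul_nat _ _)))) !comp_assoc.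
rewrite (comp_eq (act_mul_nat (mcomp A _ _ _) _)) !comp_assoc act_twisted_comp.
rewrite (comp_eq (act_mul_nat (mcomp A x u _) _)) !comp_assoc.
set p := br u y v; set q := br v z w.
move: (castcod_eq_whisker (fun o => sigma x t o T ∘ a x p o (B o t ⊗ T)
  ∘ A x p ◁ A p o ◁ b o w t T)
  (act_twist_mcompB domM twR (B w t ⊗ T) Bpv Bvz Azw)).
rewrite -!whisker_comp !comp_assoc => <-; rewrite -/q.
rewrite (comp_eq (whisker_eq _ (whisker_eq _ (act_mcompB _ _ _ _ _)))).
rewrite !comp_assoc; set s := br p v q.
(* The multiplication [a x u p] is moved outwards to meet [a x p s], so that associativity of [A]
   applies. *)
do 4! rewrite (comp_eq (esym (act_mul_nat (mcomp A x u _) _))) !comp_assoc.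
rewrite (comp_eq (act_mcompA _ _ _ _ _)) !comp_assoc.
(* Now the right side is unfolded, beginning with its inner composition. *)
rewrite (comp_eq (esym (act_mul_nat (twisted_inj _ _ _ _ _ _) _))) !comp_assoc.
move: (congr1 (fun f => A x u ◁ B u y ◁ f) (act_twisted_comp y z t v w T)).
rewrite -!whisker_comp => /comp_eq3 ->; rewrite !comp_assoc.
rewrite act_twisted_comp -/q.
move: (castcod_eq_whisker (fun o => sigma x t o T ∘ a x u o (B o t ⊗ T)
  ∘ A x u ◁ A u o ◁ b o q t T)
  (act_twist_mcompA domM twR (B q t ⊗ T) Buy Ayv Avq)).
rewrite -!whisker_comp !comp_assoc => <-; rewrite -/p -/s.
(* Both sides now consist of the same twists and multiplications through [s]; they differ by the
   order of independent factors. *)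
rewrite (comp_eq (whisker_eq _ (esym (act_mul_nat (mcomp A u p s) _)))).
rewrite !comp_assoc.
rewrite (comp_eq (whisker_eq _ (act_twist_nat _ _))) !comp_assoc.
rewrite (comp_eq (whisker_eq _ (whisker_eq _ (act_twist_nat _ _)))) !comp_assoc.
by rewrite (comp_eq (whisker_eq _ (act_twist_nat _ _))) !comp_assoc.
Qed.

Lemma twisted_is_mcategory : is_mcategory C.
Proof.
split; [exact: twisted_comp_assoc|exact: twisted_comp_idl|].
exact: twisted_comp_idr.
Qed.

(** * The two functors and the factorization *)

Lemma twisted_alphaP : is_mfunctor (twisted_alpha R D).
Proof.
split=> [x|x y z]; apply: tensor_id_inj => T.
  rewrite comp_tensor_id act_twisted_alpha !act_unitE act_twisted_id !comp_assoc.
  by rewrite (comp_eq (esym (act_unit_nat _ _))) !comp_assoc.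
apply: (initial_tensor_eq domM) => /(noninitial_tensor domM)[_ nA] _.
rewrite act_mul_tensor !act_twisted_alpha comp_tensor_id act_twisted_alpha.
rewrite act_mulE !comp_assoc (comp_eq (whisker_eq _ (act_unit_nat _ _))).
rewrite -!whisker_comp !comp_assoc act_twisted_comp.
rewrite (comp_eq (whisker_eq _ (act_twist_nat _ _))) !comp_assoc.
(* The unit [j z] is absorbed by the multiplication of [B] while the intermediate object is still
   [br y y z]; the axiom on [mid B] identifies it with [z] afterwards. *)
rewrite -(comp_assoc _ _ (sigma _ _ _ _ ∘ _)) !whisker_comp act_midBr !tensor_id.
rewrite comp_idr.
move: (castcod_eq_whisker (fun o => sigma x z o T ∘ a x y o (B o z ⊗ T))
  (act_twist_midB twR T nA)).
rewrite -!whisker_comp !comp_assoc => ->.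
by rewrite (comp_eq (act_mul_nat (mcomp A x y z) _)) !comp_assoc.
Qed.

Lemma twisted_betaP : is_mfunctor (twisted_beta R D).
Proof.
split=> [x|x y z]; apply: tensor_id_inj => T.
  by rewrite comp_tensor_id act_twisted_beta !act_unitE act_twisted_id !comp_assoc.
apply: (initial_tensor_eq domM) => /(noninitial_tensor domM)[nB _] _.
rewrite act_mul_tensor !act_twisted_beta comp_tensor_id act_twisted_beta.
rewrite act_mulE !comp_assoc (comp_eq (act_unit_nat _ _)).
rewrite -!whisker_comp !comp_assoc act_twisted_comp.
move: (castcod_eq_whisker (fun o => sigma x z o T ∘ a x x o (B o z ⊗ T)
  ∘ A x x ◁ A x o ◁ b o y z T) (act_twist_midA twR (B y z ⊗ T) nB)).
rewrite -!whisker_comp !comp_assoc => ->.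
rewrite (comp_eq (whisker_eq _ (esym (act_unit_nat _ _)))) !comp_assoc.
rewrite (comp_eq (act_midAr _ _ _)) comp_idr.
by rewrite (comp_eq (esym (act_unit_nat _ _))) !comp_assoc.
Qed.

(** The two functors insert [mid B u] and [mid A u] between [A x u] and [B u y]. The axiom on
    [mid B], applied to [A u u], interchanges these units, and the unit laws absorb them. *)
Lemma twisted_comp_alpha_beta x y u :
  mcomp C x u y ∘ (twisted_alpha R D x u ⊗₁ twisted_beta R D u y) =
  twisted_inj A B D x y u.
Proof.
apply: (initial_tensor_eq domM) => nA _; have {}nA := noninitial_endo domM nA.
apply: tensor_id_inj => T.
rewrite act_mul_tensor act_twisted_alpha act_twisted_beta act_mulE.
rewrite !comp_assoc (comp_eq (whisker_eq _ (act_unit_nat _ _))).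
rewrite -!whisker_comp !comp_assoc act_twisted_comp.
rewrite (comp_eq (whisker_eq _ (esym (act_unit_nat _ (i u _))))) !comp_assoc.
move: (castcod_eq_whisker (fun o => sigma x y o T ∘ a x u o (B o y ⊗ T)
  ∘ A x u ◁ A u o ◁ b o u y T) (act_twist_midB twR (B u y ⊗ T) nA)).
rewrite -!whisker_comp !comp_assoc => ->.
rewrite (comp_eq (whisker_comp _ _ _)) whisker_comp act_midBl !tensor_id comp_idr.
by rewrite (comp_eq (act_midAr _ _ _)) comp_idr.
Qed.

Lemma twisted_factorizes :
  factorizes D (twisted_alpha R D) (twisted_beta R D).
Proof.
move=> x y; suff -> : factor_map D (twisted_alpha R D) (twisted_beta R D) x y
    = idm _ by exists (idm _); rewrite comp_idl.
apply: (coproduct_epi (bigsum_coproduct D _)) => u.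
rewrite comp_idl; apply: (etrans _ (twisted_comp_alpha_beta x y u)).
exact: (bigsum_cotuple_inj D (fun v => mcomp C x v y
  ∘ (twisted_alpha R D x v ⊗₁ twisted_beta R D v y)) u).
Qed.

End TwistedTensor.

Theorem theorem2p14 (S : Type) (M : moncat) (D : distributive M S)
  (domM : is_domain M) (A B : mcategory M S) (br : S -> S -> S -> S)
  (R : forall x y z : S,
    (B x y ⊗ A y z ~> A x (br x y z) ⊗ B (br x y z) z)%moncat)
  (twR : simple_twisting_system R) :
  is_mcategory (twisted_tensor R D) /\
  is_mfunctor (twisted_alpha R D) /\
  is_mfunctor (twisted_beta R D) /\
  factorizes D (twisted_alpha R D) (twisted_beta R D).
Proof.
split; first exact: twisted_is_mcategory.
split; first exact: twisted_alphaP.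
split; first exact: twisted_betaP.
exact: twisted_factorizes.
Qed.
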